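(* Let $\mathbb{K}$ be a field of characteristic zero, $V=\mathbb{K}^n$, and let $\mathcal R:V\to V$ be the Reversing mapping. Let $\mathcal F_p$ and $\mathcal F_a$ denote the (canonical) Palindromicing and Antipalindromicing mappings of $V$. Then: (1) $\mathcal F_p$ and $\mathcal F_a$ are given by $$\mathcal F_p: V\to\ker(\mathcal R-id),\quad v\mapsto \tfrac12\,(v+\mathcal R(v)),\qquad \mathcal F_a: V\to\ker(\mathcal R+id),\quad v\mapsto \tfrac12\,(v-\mathcal R(v)).$$ (2) $\ker(\mathcal F_p)=\mathrm{Im}(\mathcal F_a)$ and $\ker(\mathcal F_a)=\mathrm{Im}(\mathcal F_p)$. (3) The companion matrices of $\mathcal F_p$ and $\mathcal F_a$ are $M_{\mathcal R}+I_n$ and $M_{\mathcal R}-I_n$ respectively.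
   Context: For $v=(v_1,\dots,v_n)\in\mathbb{K}^n$, $\mathcal R(v)=(v_n,v_{n-1},\dots,v_1)$; $id$ is the identity map; $I_n$ is the $n\times n$ identity matrix; $M_{\mathcal R}=(\delta_{i,n-j+1})_{n\times n}$ is the transformation matrix of $\mathcal R$, i.e. $\mathcal R(v)=vM_{\mathcal R}$. ''Companion matrix'' of a linear mapping is the term used for the matrix associated with the mapping. A vector $v$ is palindromic if $\mathcal R(v)=v$, and antipalindromic if $\mathcal R(v)=-v$. A mapping is palindromicing if it is an epimorphism from $V$ to $\ker(\mathcal R-id)$, and antipalindromicing if it is an epimorphism from $V$ to $\ker(\mathcal R+id)$. A palindromicing mapping $\mathcal F_p$ and an antipalindromicing mapping $\mathcal F_a$ are called canonical (and then called the Palindromicing and Antipalindromicing mappings) if they are linear and for all $v\in V$ satisfy $v=(\mathcal F_p+\mathcal F_a)(v)$ and $\mathcal R(v)=(\mathcal F_p-\mathcal F_a)(v)$.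
   Formalization: Part (3) as printed contradicts part (1) (for n = 1 the matrix of F_p is 1, not M_R + I_1 = 2); the companion matrices proved are (1/2)(M_R + I_n) for F_p and -(1/2)(M_R - I_n) for F_a. *)

(* Defs.v *)
From HB Require Import structures.
From mathcomp Require Import all_boot all_order all_algebra.

Set Implicit Arguments.
Unset Strict Implicit.
Unset Printing Implicit Defensive.

Import GRing.Theory.
Local Open Scope ring_scope.

Section Reversing.
Variables (K : fieldType) (n : nat).
Local Notation V := 'rV[K]_n.

(* [rev_ord j] is the 0-based form of the 1-based index n - j + 1. *)
Definition rev_row (v : V) : V := \row_j v 0 (rev_ord j).

Lemma rev_row_is_linear : linear rev_row.
Proof. by move=> a u v; apply/rowP=> j; rewrite !mxE. Qed.

HB.instance Definition _ :=
  GRing.isLinear.Build K V V _ rev_row rev_row_is_linear.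

Definition reversing : 'End(V) := linfun rev_row.

Lemma reversingE (v : V) : reversing v = rev_row v.
Proof. exact: lfunE. Qed.

Definition reversing_mx : 'M[K]_n := \matrix_(i, j) (i == rev_ord j)%:R.

Lemma reversing_mxE (v : V) : reversing v = v *m reversing_mx.
Proof.
rewrite reversingE; apply/rowP=> j; rewrite !mxE (bigD1 (rev_ord j)) //=.
rewrite mxE eqxx mulr1 big1 ?addr0 // => i ne_ij.
by rewrite mxE (negPf ne_ij) mulr0.
Qed.

(* A map V -> ker(R -/+ id) is encoded as an endomorphism of V, so that being
   an epimorphism onto the kernel means having that kernel as image. *)
Definition palindromicing (F : 'End(V)) : Prop :=
  limg F = lker (reversing - \1)%VF.

Definition antipalindromicing (F : 'End(V)) : Prop :=
  limg F = lker (reversing + \1)%VF.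

Definition canonical_pair (Fp Fa : 'End(V)) : Prop :=
  [/\ palindromicing Fp, antipalindromicing Fa,
      forall v : V, v = (Fp + Fa) v
    & forall v : V, reversing v = (Fp - Fa) v].

(* Matrices act on row vectors from the right: F v = v *m companion_mx F. *)
Definition companion_mx (F : 'End(V)) : 'M[K]_n := lin1_mx F.

Lemma companion_mxE (F : 'End(V)) (v : V) : F v = v *m companion_mx F.
Proof. by rewrite mul_rV_lin1. Qed.

End Reversing.

Arguments reversing {K n}.
Arguments reversing_mx {K n}.

(* Main.v *)
Require Import Defs.
From mathcomp Require Import all_boot all_order all_algebra.
Import GRing.Theory.
Local Open Scope ring_scope.

(* Adding and subtracting the two defining identities forces
   [2 Fp v = v + R v] and [2 Fa v = v - R v].  Since [R] is an involution,
   these half-sums are the projections onto the eigenspaces of [R] for 1 and -1,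
   and each is killed exactly on the other eigenspace. *)

Lemma reversingK (K : fieldType) (n : nat) :
  involutive (reversing : 'End('rV[K]_n)).
Proof. by move=> v; rewrite !reversingE; apply/rowP=> j; rewrite !mxE rev_ordK. Qed.

Lemma mem_lker_subr_id (K : fieldType) (vT : vectType K) (f : 'End(vT)) v :
  (v \in lker (f - \1)%VF) = (f v == v).
Proof. by rewrite memv_ker add_lfunE opp_lfunE id_lfunE subr_eq0. Qed.

Lemma mem_lker_addr_id (K : fieldType) (vT : vectType K) (f : 'End(vT)) v :
  (v \in lker (f + \1)%VF) = (f v == - v).
Proof. by rewrite memv_ker add_lfunE id_lfunE addr_eq0. Qed.

Lemma half_double (K : fieldType) (V : lmodType K) (v : V) :
  2%:R != 0 :> K -> 2%:R^-1 *: (v + v) = v.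
Proof. by move=> nz2; rewrite -mulr2n -scaler_nat scalerA mulVf // scale1r. Qed.

Lemma half_eq0 (K : fieldType) (V : lmodType K) (v : V) :
  2%:R != 0 :> K -> (2%:R^-1 *: v == 0) = (v == 0).
Proof. by move=> nz2; rewrite scaler_eq0 invr_eq0; case: eqP nz2. Qed.

Section HalfSums.
Variables (K : fieldType) (n : nat).
Hypothesis nz2 : 2%:R != 0 :> K.
Local Notation V := 'rV[K]_n.
Variables Fp Fa : 'End(V).
Hypothesis FpE : forall v, Fp v = 2%:R^-1 *: (v + reversing v).
Hypothesis FaE : forall v, Fa v = 2%:R^-1 *: (v - reversing v).

(** Reversal swaps the summands of [u + reversing u], so every image is fixed; conversely a fixed
    [v] is its own half-sum, hence its own preimage. *)
Lemma half_sum_palindromicing : palindromicing Fp.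
Proof.
apply/vspaceP=> v; rewrite mem_lker_subr_id; apply/memv_imgP/eqP.
  by case=> u _ ->; rewrite FpE linearZ linearD /= reversingK addrC.
by move=> Rv; exists v; rewrite ?memvf // FpE Rv half_double.
Qed.

Lemma half_diff_antipalindromicing : antipalindromicing Fa.
Proof.
apply/vspaceP=> v; rewrite mem_lker_addr_id; apply/memv_imgP/eqP.
  by case=> u _ ->; rewrite FaE linearZ linearB /= reversingK -scalerN opprB.
by move=> Rv; exists v; rewrite ?memvf // FaE Rv opprK half_double.
Qed.

(** The eigenspace for -1 is also the image that [antipalindromicing] prescribes, which links this
    kernel to [limg Fa]. *)
Lemma lker_half_sum : lker Fp = lker (reversing + \1)%VF.
Proof.
apply/vspaceP=> v; rewrite [RHS]mem_lker_addr_id memv_ker FpE.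
by rewrite half_eq0 // (addrC v) addr_eq0.
Qed.

Lemma lker_half_diff : lker Fa = lker (reversing - \1)%VF.
Proof.
apply/vspaceP=> v; rewrite [RHS]mem_lker_subr_id memv_ker FaE.
by rewrite half_eq0 // subr_eq0 eq_sym.
Qed.

Lemma half_sum_diff_canonical : canonical_pair Fp Fa.
Proof.
split=> [||v|v].
- exact: half_sum_palindromicing.
- exact: half_diff_antipalindromicing.
- by rewrite add_lfunE FpE FaE -scalerDr addrACA subrr addr0 half_double.
- rewrite add_lfunE opp_lfunE FpE FaE -scalerBr opprB addrC addrA subrK.
  by rewrite half_double.
Qed.

End HalfSums.

Lemma canonical_pairE (K : fieldType) (n : nat) (Fp Fa : 'End('rV[K]_n)) :
  2%:R != 0 :> K -> canonical_pair Fp Fa ->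
  (forall v, Fp v = 2%:R^-1 *: (v + reversing v)) /\
  (forall v, Fa v = 2%:R^-1 *: (v - reversing v)).
Proof.
move=> nz2 [_ _ sumE diffE]; split=> v.
  (* Occurrence 2 is the bare summand [v]; expanding it as [(Fp + Fa) v] cancels [Fa v] and leaves
     [Fp v + Fp v]. *)
  rewrite diffE {2}[v]sumE !add_lfunE opp_lfunE addrACA subrr addr0.
  by rewrite half_double.
rewrite diffE {2}[v]sumE !add_lfunE opp_lfunE opprB addrC addrA subrK.
by rewrite half_double.
Qed.

(** Row [i] of a matrix is the image of the [i]-th standard basis vector, so the action on row
    vectors determines the matrix. *)
Lemma companion_mx_unique (K : fieldType) (n : nat) (F : 'End('rV[K]_n)) A :
  (forall v, F v = v *m A) -> companion_mx F = A.
Proof. by move=> FA; apply/row_matrixP=> i; rewrite !rowE -companion_mxE FA. Qed.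

(** The existence clause keeps the universal one from being vacuous. By the half-sum formulas,
    [reversing_mx + 1%:M] and [reversing_mx - 1%:M] represent twice [Fp] and minus twice [Fa],
    whence the scalars 1/2 and -1/2 in the companion matrices. *)
Theorem proposition2p3 (K : fieldType) (charK0 : [pchar K] =i pred0) (n : nat) :
  (exists Fp Fa : 'End('rV[K]_n), canonical_pair Fp Fa) /\
  (forall Fp Fa : 'End('rV[K]_n), canonical_pair Fp Fa ->
    [/\ (forall v, Fp v = 2%:R^-1 *: (v + reversing v)) /\
        (forall v, Fa v = 2%:R^-1 *: (v - reversing v)),
        lker Fp = limg Fa /\ lker Fa = limg Fp
      & companion_mx Fp = 2%:R^-1 *: (reversing_mx + 1%:M) /\
        companion_mx Fa = - 2%:R^-1 *: (reversing_mx - 1%:M)]).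
Proof.
(* Since 2 is prime, it fails to be a characteristic of [K] only if it is nonzero in [K]. *)
have nz2 : 2%:R != 0 :> K by have := charK0 2; rewrite !inE /= => ->.
split.
  exists (2%:R^-1 *: (\1 + reversing))%VF, (2%:R^-1 *: (\1 - reversing))%VF.
  by apply: half_sum_diff_canonical => // v;
    rewrite scale_lfunE add_lfunE ?opp_lfunE id_lfunE.
move=> Fp Fa canF; have [FpE FaE] := canonical_pairE _ _ _ _ nz2 canF.
have [palFp antiFa _ _] := canF.
split=> //; split.
(* Both sides are the eigenspace for -1: the kernel by computation, the image by [antiFa]. *)
- by rewrite (lker_half_sum _ _ nz2 _ FpE).
- by rewrite (lker_half_diff _ _ nz2 _ FaE).
- apply: companion_mx_unique => v.
  by rewrite FpE reversing_mxE -scalemxAr mulmxDr mulmx1 addrC.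
- apply: companion_mx_unique => v.
  by rewrite FaE reversing_mxE -scalemxAr mulmxBr mulmx1 scaleNr -scalerN opprB.
Qed.
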